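(* Let $k\ge 1$ and $p\ge 1$ be integers, let $\mathcal{M}$ be a smooth manifold, let $\mathbf{X}=(X_1,\dots,X_k)$ be a $k$-vector field on $\mathcal{M}$, and let $(\omega_1,\dots,\omega_k)$ be a family of $p$-forms on $\mathcal{M}$ which are invariant for $\mathbf{X}$, i.e. $L_{X_A}\omega_A=0$ for each $A=1,\dots,k$ (no summation over $A$). Let $Y$ be a vector field on $\mathcal{M}$ which is a symmetry of $\mathbf{X}$, and let $\mathbf{Y}=(Y,\dots,Y)$ be the $k$-vector field all of whose $k$ components equal $Y$. If $S_1,\dots,S_{p-1}$ are $p-1$ vector fields on $\mathcal{M}$ which are $\mathbf{Y}$-pseudosymmetries of $\mathbf{X}$, then the map $\mathbf{\Phi}=(\Phi_1,\dots,\Phi_k):\mathcal{M}\to\mathbb{R}^k$ defined by $$\Phi_A=\omega_A(S_1,\dots,S_{p-1},Y),\qquad A=1,\dots,k,$$ is a conservation law for $\mathbf{X}=(X_1,\dots,X_k)$. In particular, if $Y,S_1,\dots,S_{p-1}$ are symmetries of $\mathbf{X}$, then $\mathbf{\Phi}$ is a conservation law for $\mathbf{X}$.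
   Context: All manifolds, maps, vector fields and forms are $C^\infty$. $L_X$ denotes the Lie derivative; for vector fields $L_XY=[X,Y]$. A $k$-vector field on $\mathcal{M}$ is a section of the Whitney sum $T\mathcal{M}\oplus\cdots\oplus T\mathcal{M}$ ($k$ copies) over $\mathcal{M}$, i.e. a $k$-tuple $\mathbf{X}=(X_1,\dots,X_k)$ of vector fields on $\mathcal{M}$. A map $\mathbf{\Phi}=(\Phi_1,\dots,\Phi_k):\mathcal{M}\to\mathbb{R}^k$ is a conservation law for the $k$-vector field $\mathbf{X}$ if $\sum_{A=1}^{k}L_{X_A}\Phi_A=0$. A vector field $Y$ on $\mathcal{M}$ is a symmetry of $\mathbf{X}$ if $L_{X_A}Y=0$ for all $A=1,\dots,k$. Given a fixed $k$-vector field $\mathbf{Z}=(Z_1,\dots,Z_k)$ on $\mathcal{M}$, a vector field $S$ on $\mathcal{M}$ is a $\mathbf{Z}$-pseudosymmetry of $\mathbf{X}$ if for every $A=1,\dots,k$ there are functions $\lambda_A^B\in C^\infty(\mathcal{M})$, $B=1,\dots,k$, such that $L_{X_A}S=\sum_{B=1}^{k}\lambda_A^B Z_B$. *)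

(* Defs.v *)
From HB Require Import structures.
From mathcomp Require Import all_boot all_order all_algebra.
From mathcomp Require Import all_classical all_reals all_analysis.
From mathcomp Require Import ring.

Set Implicit Arguments.
Unset Strict Implicit.
Unset Printing Implicit Defensive.

Import Order.TTheory GRing.Theory Num.Theory.
Import numFieldNormedType.Exports.

Local Open Scope classical_set_scope.
Local Open Scope ring_scope.

Section Euclidean.
Variables (R : realType) (n : nat).
Implicit Types (U : set 'rV[R]_n) (f g : 'rV[R]_n -> R).

(* Both notions only make sense for U open: the values of f near U matter. *)
Fixpoint Ck (k : nat) U f : Prop :=
  (forall x, U x -> {for x, continuous f}) /\
  match k with
  | 0%N => True
  | k'.+1 => forall i : 'I_n,
      (forall x, U x -> derivable f x (delta_mx 0 i)) /\
      Ck k' U (fun x => 'D_(delta_mx 0 i) f x)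
  end.

Definition smooth_on U f : Prop := forall k, Ck k U f.

Lemma Ck_cont k U f : Ck k U f -> forall x, U x -> {for x, continuous f}.
Proof. by case: k => [|k] []. Qed.

Lemma CkS k U f : Ck k.+1 U f -> Ck k U f.
Proof.
elim: k f => [|k IHk] f; first by case.
by move=> [cf df]; split=> // i; have [dfi /IHk] := df i.
Qed.

Lemma eq_in_near U f g x : open U -> {in U, f =1 g} -> U x ->
  \near x, f x = g x.
Proof.
move=> oU fg Ux; near=> y; apply: fg; rewrite inE.
by near: y; exact: open_nbhs_nbhs.
Unshelve. all: by end_near. Qed.

Lemma eq_in_cont U f g x : open U -> {in U, f =1 g} -> U x ->
  {for x, continuous f} -> {for x, continuous g}.
Proof.
move=> oU fg Ux cf; rewrite /prop_for /continuous_at -(fg x) ?inE//.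
apply: cvg_trans cf; apply: (@near_eq_cvg _ _ (nbhs x)).
exact: eq_in_near fg Ux.
Qed.

Lemma eq_Ck k U f g : open U -> {in U, f =1 g} -> Ck k U f -> Ck k U g.
Proof.
move=> oU; elim: k f g => [|k IHk] f g fg [cf df].
  by split=> // x Ux; exact: eq_in_cont oU fg Ux (cf x Ux).
split=> [x Ux|i]; first exact: eq_in_cont oU fg Ux (cf x Ux).
have [dfi kfi] := df i; split.
  by move=> x Ux; apply: near_eq_derivable (dfi x Ux); exact: eq_in_near fg Ux.
apply: IHk kfi => x; rewrite inE => Ux.
by apply: near_eq_derive; exact: eq_in_near fg Ux.
Qed.

Lemma Ck_cst k U (c : R) : Ck k U (cst c).
Proof.
elim: k c => [|k IHk] c; split=> //; try by move=> x _; exact: cst_continuous.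
move=> i; split=> [x _|]; first exact: derivable_cst.
rewrite (_ : (fun x => _) = cst 0) //.
by apply/funext => x /=; rewrite derive_cst.
Qed.

Lemma CkD k U f g : open U -> Ck k U f -> Ck k U g -> Ck k U (f + g).
Proof.
move=> oU; elim: k f g => [|k IHk] f g [cf df] [cg dg].
  by split=> // x Ux; apply: continuousD; [exact: cf|exact: cg].
split=> [x Ux|i]; first by apply: continuousD; [exact: cf|exact: cg].
have [dfi kfi] := df i; have [dgi kgi] := dg i; split=> [x Ux|].
  by apply: derivableD; [exact: dfi|exact: dgi].
apply: eq_Ck (IHk _ _ kfi kgi) => // x; rewrite inE => Ux.
by rewrite deriveD //; [exact: dfi|exact: dgi].
Qed.

Lemma CkM k U f g : open U -> Ck k U f -> Ck k U g -> Ck k U (f * g).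
Proof.
move=> oU; elim: k f g => [|k IHk] f g kf kg.
  split=> // x Ux; apply: continuousM.
    exact: Ck_cont kf _ Ux.
  exact: Ck_cont kg _ Ux.
split=> [x Ux|i].
  by apply: continuousM; [exact: Ck_cont kf _ Ux|exact: Ck_cont kg _ Ux].
have [_ /(_ i) [dfi kfi]] := kf; have [_ /(_ i) [dgi kgi]] := kg.
split=> [x Ux|]; first by apply: derivableM; [exact: dfi|exact: dgi].
apply: eq_Ck (CkD oU (IHk _ _ (CkS kf) kgi) (IHk _ _ (CkS kg) kfi)) => // x.
by rewrite inE => Ux; rewrite deriveM //; [exact: dfi|exact: dgi].
Qed.

Lemma smooth_on_cst U (c : R) : smooth_on U (cst c).
Proof. by move=> k; exact: Ck_cst. Qed.

Lemma smooth_onD U f g :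
  open U -> smooth_on U f -> smooth_on U g -> smooth_on U (f + g).
Proof. by move=> oU sf sg k; exact: CkD. Qed.

Lemma smooth_onM U f g :
  open U -> smooth_on U f -> smooth_on U g -> smooth_on U (f * g).
Proof. by move=> oU sf sg k; exact: CkM. Qed.

End Euclidean.

(* chart_map and chart_inv are total functions, meaningful only on chart_dom
   and on its image chart_cod respectively. *)
Record chart (R : realType) (n : nat) (M : topologicalType) := Chart {
  chart_dom : set M;
  chart_map : M -> 'rV[R]_n;
  chart_inv : 'rV[R]_n -> M;
  chart_cod := chart_map @` chart_dom;
  chart_dom_open : open chart_dom;
  chart_cod_open : open chart_cod;
  chart_mapK : {in chart_dom, cancel chart_map chart_inv};
  chart_map_cont : {within chart_dom, continuous chart_map};
  chart_inv_cont : {within chart_cod, continuous chart_inv} }.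

Definition chart_compat (R : realType) (n : nat) (M : topologicalType)
    (c1 c2 : chart R n M) : Prop :=
  forall i : 'I_n,
    smooth_on (chart_map c1 @` (chart_dom c1 `&` chart_dom c2))
              (fun u => chart_map c2 (chart_inv c1 u) 0 i).

(* The atlas is not required to be maximal: any smooth atlas determines the
   smooth structure. *)
Record manifold (R : realType) := Manifold {
  carrier :> topologicalType;
  mdim : nat;
  atlas : set (chart R mdim carrier);
  manifold_hausdorff : hausdorff_space carrier;
  manifold_second_countable : @second_countable carrier;
  atlas_cover : forall x : carrier, exists2 c, atlas c & chart_dom c x;
  atlas_compat : forall c1 c2, atlas c1 -> atlas c2 -> chart_compat c1 c2 }.

Section SmoothFunctions.
Variables (R : realType) (M : manifold R).

Definition smooth (f : M -> R) : Prop :=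
  forall c, atlas c -> smooth_on (chart_cod c) (f \o chart_inv c).

Definition smooth_pred : {pred M -> R} := fun f => `[< smooth f >].

Record smoothfun := SmoothFun {
  smoothfun_val :> M -> R;
  smoothfun_in : smoothfun_val \in smooth_pred }.

HB.instance Definition _ := [isSub for smoothfun_val].
HB.instance Definition _ := [Choice of smoothfun by <:].

Lemma smoothfunP (f : smoothfun) : smooth f.
Proof. by have /asboolP := smoothfun_in f. Qed.

Definition mksmooth (f : M -> R) (sf : smooth f) : smoothfun :=
  @SmoothFun f (asboolT sf).

Lemma smoothfun_ext (f g : smoothfun) : (forall x, f x = g x) -> f = g.
Proof. by move=> fg; apply/val_inj/funext. Qed.

Lemma smooth_cst (c : R) : smooth (cst c).
Proof. by move=> ch _; exact: smooth_on_cst. Qed.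

Lemma smoothD (f g : M -> R) : smooth f -> smooth g -> smooth (f + g).
Proof.
move=> sf sg c ac; apply: smooth_onD; first exact: chart_cod_open.
  exact: sf.
exact: sg.
Qed.

Lemma smoothM (f g : M -> R) : smooth f -> smooth g -> smooth (f * g).
Proof.
move=> sf sg c ac; apply: smooth_onM; first exact: chart_cod_open.
  exact: sf.
exact: sg.
Qed.

Lemma smoothN (f : M -> R) : smooth f -> smooth (- f).
Proof. by rewrite -mulN1r => sf; apply: smoothM => //; exact: (smooth_cst (- 1)). Qed.

Lemma smooth_subring_closed : subring_closed smooth_pred.
Proof.
split=> [|f g /asboolP sf /asboolP sg|f g /asboolP sf /asboolP sg].
- exact/asboolP/smooth_cst.
- by apply/asboolP/smoothD => //; exact: smoothN.
- exact/asboolP/smoothM.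
Qed.

HB.instance Definition _ :=
  GRing.SubChoice_isSubComPzRing.Build (M -> R) smooth_pred smoothfun
    smooth_subring_closed.

Definition smooth_const (c : R) : smoothfun := mksmooth (smooth_cst c).

End SmoothFunctions.

Section VectorFields.
Variables (R : realType) (M : manifold R).

(* Tangent vectors at x are the derivations at x of the R-algebra C^oo(M); M
   being Hausdorff and second countable, global functions suffice. *)
Definition is_derivation_at (x : M) (v : smoothfun M -> R) : Prop :=
  [/\ forall f g, v (f + g) = v f + v g,
      forall (a : R) f, v (smooth_const M a * f) = a * v f &
      forall f g, v (f * g) = f x * v g + g x * v f].

Definition derivation_pred (x : M) : {pred smoothfun M -> R^o} :=
  fun v => `[< is_derivation_at x v >].

Record tangent (x : M) := Tangent {
  tangent_val :> smoothfun M -> R^o;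
  tangent_in : tangent_val \in derivation_pred x }.

HB.instance Definition _ (x : M) := [isSub of tangent x for @tangent_val x].
HB.instance Definition _ (x : M) := [Choice of tangent x by <:].

Lemma tangentP (x : M) (v : tangent x) : is_derivation_at x v.
Proof. by have /asboolP := tangent_in v. Qed.

Definition mktangent (x : M) (v : smoothfun M -> R)
  (dv : is_derivation_at x v) : tangent x := @Tangent x v (asboolT dv).

Lemma tangent_ext (x : M) (v w : tangent x) : (forall f, v f = w f) -> v = w.
Proof. by move=> vw; apply/val_inj/funext. Qed.

Lemma derivation_submod_closed (x : M) : submod_closed (derivation_pred x).
Proof.
split=> [|a v w /asboolP [vD vZ vM] /asboolP [wD wZ wM]]; apply/asboolP.
  by split=> *; rewrite /GRing.zero/= ?addr0 ?mulr0 ?addr0.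
have E f : (a *: v + w) f = a * v f + w f by [].
split=> [f g|b f|f g]; rewrite !E.
- by rewrite vD wD mulrDr addrACA.
- by rewrite vZ wZ mulrDr mulrCA.
- by rewrite vM wM !mulrDr addrACA ![a * (_ * _)]mulrCA.
Qed.

HB.instance Definition _ (x : M) :=
  GRing.SubChoice_isSubLmodule.Build R (smoothfun M -> R^o)
    (derivation_pred x) (tangent x) (derivation_submod_closed x).

(* A section of the tangent bundle is smooth iff it maps smooth functions to
   smooth functions. A k-vector field is a family 'I_k -> vfield. *)
Record vfield := VField {
  vfield_at :> forall x : M, tangent x;
  vfield_smooth : forall f : smoothfun M, smooth (fun x => vfield_at x f) }.

Lemma vfield_ext (X Y : vfield) : (forall x f, X x f = Y x f) -> X = Y.
Proof.
case: X Y => [X sX] [Y sY] /= XY.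
have E : X = Y by apply: functional_extensionality_dep => x; exact/tangent_ext.
by subst Y; congr VField; exact: Prop_irrelevance.
Qed.

HB.instance Definition _ := gen_eqMixin vfield.
HB.instance Definition _ := gen_choiceMixin vfield.

Definition lie_fun (X : vfield) (f : smoothfun M) : smoothfun M :=
  mksmooth (vfield_smooth X f).

Fact vfield_zero_smooth (f : smoothfun M) :
  smooth (fun x : M => (0 : tangent x) f).
Proof. exact: smooth_cst. Qed.
Definition vfield_zero := VField vfield_zero_smooth.

Fact vfield_opp_smooth (X : vfield) (f : smoothfun M) :
  smooth (fun x => (- X x) f).
Proof. exact: smoothN (vfield_smooth X f). Qed.
Definition vfield_opp X := VField (vfield_opp_smooth X).

Fact vfield_add_smooth (X Y : vfield) (f : smoothfun M) :
  smooth (fun x => (X x + Y x) f).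
Proof. exact: smoothD (vfield_smooth X f) (vfield_smooth Y f). Qed.
Definition vfield_add X Y := VField (vfield_add_smooth X Y).

Fact vfield_scale_smooth (h : smoothfun M) (X : vfield) (f : smoothfun M) :
  smooth (fun x => (h x *: X x) f).
Proof. exact: smoothM (smoothfunP h) (vfield_smooth X f). Qed.
Definition vfield_scale h X := VField (vfield_scale_smooth h X).

Fact vfield_addA : associative vfield_add.
Proof. by move=> X Y Z; apply: vfield_ext => x f; rewrite /= addrA. Qed.
Fact vfield_addC : commutative vfield_add.
Proof. by move=> X Y; apply: vfield_ext => x f; rewrite /= addrC. Qed.
Fact vfield_add0 : left_id vfield_zero vfield_add.
Proof. by move=> X; apply: vfield_ext => x f; rewrite /= add0r. Qed.
Fact vfield_addN : left_inverse vfield_zero vfield_opp vfield_add.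
Proof. by move=> X; apply: vfield_ext => x f; rewrite /= addNr. Qed.

HB.instance Definition _ :=
  GRing.isZmodule.Build vfield vfield_addA vfield_addC vfield_add0 vfield_addN.

Fact vfield_scaleA h k X :
  vfield_scale h (vfield_scale k X) = vfield_scale (h * k) X.
Proof. by apply: vfield_ext => x f; rewrite /= scalerA. Qed.
Fact vfield_scale1 : left_id 1 vfield_scale.
Proof. by move=> X; apply: vfield_ext => x f; rewrite /= scale1r. Qed.
Fact vfield_scaleDr : right_distributive vfield_scale +%R.
Proof. by move=> h X Y; apply: vfield_ext => x f; rewrite /= scalerDr. Qed.
Fact vfield_scaleDl X : {morph vfield_scale^~ X : h k / h + k}.
Proof. by move=> h k; apply: vfield_ext => x f; rewrite /= scalerDl. Qed.

HB.instance Definition _ :=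
  GRing.Zmodule_isLmodule.Build (smoothfun M) vfield
    vfield_scaleA vfield_scale1 vfield_scaleDr vfield_scaleDl.

Lemma lie_funD X f g : lie_fun X (f + g) = lie_fun X f + lie_fun X g.
Proof. by apply: smoothfun_ext => x; have [XD _ _] := tangentP (X x); exact: XD. Qed.

Lemma lie_funZ X a f :
  lie_fun X (smooth_const M a * f) = smooth_const M a * lie_fun X f.
Proof. by apply: smoothfun_ext => x; have [_ XZ _] := tangentP (X x); exact: XZ. Qed.

Lemma lie_funM X f g : lie_fun X (f * g) = f * lie_fun X g + g * lie_fun X f.
Proof. by apply: smoothfun_ext => x; have [_ _ XM] := tangentP (X x); exact: XM. Qed.

Fact bracket_derivation (X Y : vfield) (x : M) :
  is_derivation_at x (fun f => X x (lie_fun Y f) - Y x (lie_fun X f)).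
Proof.
have [XD XZ XM] := tangentP (X x); have [YD YZ YM] := tangentP (Y x).
split=> [f g|a f|f g].
- by rewrite !lie_funD XD YD opprD addrACA.
- by rewrite !lie_funZ XZ YZ mulrBr.
rewrite !lie_funM XD YD !XM !YM /=; ring.
Qed.

Fact bracket_smooth (X Y : vfield) (f : smoothfun M) :
  smooth (fun x => mktangent (bracket_derivation X Y x) f).
Proof. exact: smoothfunP (lie_fun X (lie_fun Y f) - lie_fun Y (lie_fun X f)). Qed.

(* L_X Y = [X, Y], i.e. the field f |-> X (Y f) - Y (X f). *)
Definition lie_vfield (X Y : vfield) : vfield := VField (bracket_smooth X Y).

End VectorFields.

Definition upd (p : nat) (T : Type) (v : 'I_p -> T) (i : 'I_p) (w : T) :
  'I_p -> T := fun j => if j == i then w else v j.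

Section Forms.
Variables (R : realType) (M : manifold R) (p : nat).

(* A section of the p-th exterior power of the cotangent bundle is smooth iff
   its values on smooth vector fields are smooth functions. *)
Record diffform := DiffForm {
  form_at :> forall x : M, ('I_p -> tangent x) -> R;
  form_linear : forall (x : M) (v : 'I_p -> tangent x) (i : 'I_p) (a : R)
      (u w : tangent x),
    form_at (upd v i (a *: u + w)) = a * form_at (upd v i u) + form_at (upd v i w);
  form_alternating : forall (x : M) (v : 'I_p -> tangent x) (i j : 'I_p),
    i != j -> v i = v j -> form_at v = 0;
  form_smooth : forall V : 'I_p -> vfield M,
    smooth (fun x => form_at (fun i => V i x)) }.

Definition form_app (w : diffform) (V : 'I_p -> vfield M) : smoothfun M :=
  mksmooth (form_smooth w V).

(* (L_X w)(V_1, ..., V_p) = X (w (V_1, ..., V_p))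
     - \sum_i w (V_1, ..., [X, V_i], ..., V_p),
   the Leibniz extension of lie_fun and lie_vfield to forms. It is C^oo(M)-multilinear in V, so that the p-form L_X w vanishes
   exactly when this function of V does. *)
Definition lie_form (X : vfield M) (w : diffform) (V : 'I_p -> vfield M) :
    smoothfun M :=
  lie_fun X (form_app w V) -
  \sum_(i < p) form_app w (upd V i (lie_vfield X (V i))).

Definition invariant_form (X : vfield M) (w : diffform) : Prop :=
  lie_form X w = fun=> 0.

End Forms.

(* The p-tuple (S_1, ..., S_{p-1}, Y), for p > 0. *)
Definition rcons_arg (p : nat) (T : Type) (S : 'I_p.-1 -> T) (Y : T) :
  'I_p -> T := fun i => oapp S Y (insub (val i)).

Section Symmetries.
Variables (R : realType) (M : manifold R) (k : nat).
Implicit Types X Z : 'I_k -> vfield M.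

Definition conservation_law X (Phi : 'I_k -> smoothfun M) : Prop :=
  \sum_(A < k) lie_fun (X A) (Phi A) = 0.

Definition symmetry X (Y : vfield M) : Prop :=
  forall A, lie_vfield (X A) Y = 0.

Definition pseudosymmetry Z X (S : vfield M) : Prop :=
  forall A, exists lambda : 'I_k -> smoothfun M,
    lie_vfield (X A) S = \sum_(B < k) lambda B *: Z B.

End Symmetries.

(* Main.v *)
Require Import Defs.
From mathcomp Require Import all_boot all_order all_algebra.
From mathcomp Require Import all_classical all_reals all_analysis.

(** Every summand [X_A (Phi_A)] vanishes by itself.  Since [L_{X_A} omega_A = 0],
    the Leibniz rule turns [X_A (omega_A (V_1, ..., V_p))] into the sum over [i]
    of the values of [omega_A] in which [V_i] is replaced by [[X_A, V_i]].  For
    [V = (S_1, ..., S_{p-1}, Y)] every such bracket is a function times [Y]: by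
    pseudosymmetry when [i < p], and because [[X_A, Y] = 0] when [i = p].  If
    [i < p], the multiple of [Y] meets the last argument [Y] and alternation
    kills the term; if [i = p], the new argument is zero and linearity kills it.
    This is [lie_fun_invariant_form_app].  A symmetry is a pseudosymmetry with
    all coefficients zero, which gives the second claim. *)

Set Implicit Arguments.
Unset Strict Implicit.
Unset Printing Implicit Defensive.

Import GRing.Theory.

Local Open Scope ring_scope.

Section FormValues.
Variables (R : realType) (M : manifold R) (p : nat) (w : diffform M p).
Implicit Types (V : 'I_p -> vfield M) (i m : 'I_p).

Lemma form_upd0 (x : M) (v : 'I_p -> tangent x) i : w x (upd v i 0) = 0.
Proof.
have := form_linear w v i 1 0 0.
by rewrite scale1r addr0 mul1r -{1}[w x _]addr0 => /addrI.
Qed.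

Lemma form_updZ (x : M) (v : 'I_p -> tangent x) i (a : R) (u : tangent x) :
  w x (upd v i (a *: u)) = a * w x (upd v i u).
Proof. by rewrite -[a *: u]addr0 form_linear form_upd0 addr0. Qed.

Lemma upd_at V i (W : vfield M) (x : M) :
  (fun j => upd V i W j x) = upd (fun j => V j x) i (W x).
Proof. by apply/funext => j; rewrite /upd; case: ifP. Qed.

(** The pointwise linearity of a form becomes linearity over smooth functions,
    because a function acts on fields through its value at each point. *)
Lemma form_app_updZ V i (h : smoothfun M) (W : vfield M) :
  form_app w (upd V i (h *: W)) = h * form_app w (upd V i W).
Proof. by apply: smoothfun_ext => x /=; rewrite upd_at form_updZ -upd_at. Qed.

Lemma form_app_upd_repeat V i m : i != m -> form_app w (upd V i (V m)) = 0.
Proof.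
move=> im; apply: smoothfun_ext => x /=.
by apply: (form_alternating w im); rewrite /upd eqxx eq_sym (negbTE im).
Qed.

(** Moving along [X] changes each argument only in the direction of the fixed
    argument [V m], and leaves [V m] itself unchanged; an alternating form does
    not see such changes. *)
Lemma lie_fun_invariant_form_app (X : vfield M) V m :
    invariant_form X w -> lie_vfield X (V m) = 0 ->
    (forall i, i != m -> exists h : smoothfun M,
       lie_vfield X (V i) = h *: V m) ->
  lie_fun X (form_app w V) = 0.
Proof.
move=> /(congr1 (@^~ V)) /subr0_eq -> Xm Xi.
apply: big1 => i _; have [->|im] := eqVneq i m.
  by rewrite Xm -(scale0r (V m)) form_app_updZ mul0r.
by have [h ->] := Xi i im; rewrite form_app_updZ form_app_upd_repeat// mulr0.
Qed.

End FormValues.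

Lemma symmetry_pseudosymmetry (R : realType) (M : manifold R) (k : nat)
    (Z X : 'I_k -> vfield M) (S : vfield M) :
  symmetry X S -> pseudosymmetry Z X S.
Proof.
move=> XS A; exists (fun=> 0); rewrite XS big1// => B _; exact: scale0r.
Qed.

Theorem theorem5p5 (R : realType) (k p : nat) (hk : (1 <= k)%N) (hp : (1 <= p)%N)
    (M : manifold R) (X : 'I_k -> vfield M) (omega : 'I_k -> diffform M p)
    (homega : forall A : 'I_k, invariant_form (X A) (omega A))
    (Y : vfield M) (hY : symmetry X Y) (S : 'I_p.-1 -> vfield M) :
  let Phi : 'I_k -> smoothfun M :=
    fun A => form_app (omega A) (rcons_arg S Y) in
  ((forall j, pseudosymmetry (fun=> Y) X (S j)) -> conservation_law X Phi) /\
  ((forall j, symmetry X (S j)) -> conservation_law X Phi).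
Proof.
move=> Phi.
suff main : (forall j, pseudosymmetry (fun=> Y) X (S j)) -> conservation_law X Phi.
  by split=> // sS; apply: main => j; exact: symmetry_pseudosymmetry.
move=> psS; apply: big1 => A _.
have lt_last : (p.-1 < p)%N by rewrite prednK.
pose m := Ordinal lt_last.
have Vm : rcons_arg S Y m = Y by rewrite /rcons_arg insubN //= ltnn.
apply: (lie_fun_invariant_form_app (m := m)) => //; first by rewrite Vm.
move=> i im; rewrite Vm /rcons_arg.
case: insubP => [j _ _|] /=.
  by have [l ->] := psS j A; exists (\sum_(B < k) l B); rewrite scaler_suml.
(* The only index outside the range of S is the last one. *)
rewrite -leqNgt => le_i; case/negP: im; apply/eqP/val_inj => /=.
by apply/eqP; rewrite eqn_leq le_i -ltnS prednK// ltn_ord.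
Qed.
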